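(* Let $0\le n\le N-1$ and let $(h_K^n)_{K\in\mathcal M}$ and $(u^n_{i,\sigma})_{\sigma\in\mathcal E^{(i)}}$, $i=1,2$, be given (with $u^n_{i,\sigma}=0$ for boundary edges $\sigma$), such that $h_K^n\ge 0$ for all $K\in\mathcal M$. Let $(h_K^{n+1})_{K\in\mathcal M}$ be computed by the discrete mass balance with upwind fluxes $$\frac{1}{\delta t}(h_K^{n+1}-h_K^n)+\frac1{|K|}\sum_{\sigma\in\mathcal E(K)}|\sigma|\,h^n_\sigma\,u^n_{K,\sigma}=0,\qquad K\in\mathcal M .$$ Then $h_K^{n+1}\ge 0$ for all $K\in\mathcal M$ under the CFL condition $$\delta t\le\frac{|K|}{\sum_{\sigma\in\mathcal E(K)}|\sigma|\,|u^n_{K,\sigma}|}\qquad\text{for all }K\in\mathcal M .$$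
   Context: $\Omega\subset\mathbb R^2$ is a bounded connected open set which is a union of rectangles with edges orthogonal to the canonical basis vectors $e^{(1)},e^{(2)}$. $\mathcal M$ is a conforming structured (possibly non uniform) partition of $\Omega$ into rectangles $K$ with axis-parallel edges; $\mathcal E$ is the set of edges of the cells, $\mathcal E(K)$ the set of the four edges of $K$, and $\mathcal E^{(i)}$ the set of edges orthogonal to $e^{(i)}$. An edge is internal if it separates two cells, $\sigma=K|L=\partial K\cap\partial L$, and otherwise it lies on $\partial\Omega$ (boundary edge). $|\cdot|$ is the one- or two-dimensional measure. $\delta t=T/N>0$ is the time step ($T>0$, $N\geq 1$ an integer). Discrete water heights are values $h_K$, one per cell; the $i$-th velocity component is given by values $u_{i,\sigma}$, one per edge $\sigma\in\mathcal E^{(i)}$, vanishing on boundary edges. With $n_{K,\sigma}$ the unit normal to $\sigma$ outward $K$, set $u_{K,\sigma}=u_{i,\sigma}\,n_{K,\sigma}\cdot e^{(i)}$ for $\sigma\in\mathcal E(K)\cap\mathcal E^{(i)}$ (so $u_{K,\sigma}=0$ on boundary edges). The upwind height at an internal edge $\sigma=K|L$ is $h_\sigma=h_K$ if $u_{K,\sigma}\ge0$ and $h_\sigma=h_L$ otherwise; on boundary edges the flux $|\sigma|h_\sigma u_{K,\sigma}$ is $0$. The right-hand side of the CFL condition is understood as $+\infty$ if its denominator vanishes. *)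

(* Defs.v *)
From HB Require Import structures.
From mathcomp Require Import all_boot all_order all_algebra.
From mathcomp Require Import all_classical all_reals all_analysis.

Set Implicit Arguments.
Unset Strict Implicit.
Unset Printing Implicit Defensive.

Import Order.TTheory GRing.Theory Num.Theory.
Import numFieldNormedType.Exports.

Local Open Scope classical_set_scope.
Local Open Scope ring_scope.

Section Geometry.
Variable R : realType.
Implicit Types (a b p : 'rV[R]_2) (A Omega : set 'rV[R]_2).

Definition basis_vec (T : pzRingType) (i : 'I_2) : 'rV[T]_2 := delta_mx 0 i.

Definition dot (x y : 'rV[R]_2) : R := \sum_i x 0 i * y 0 i.

Definition rect a b : set 'rV[R]_2 :=
  [set p | forall i, a 0 i <= p 0 i <= b 0 i].

Definition open_rect a b : set 'rV[R]_2 :=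
  [set p | forall i, a 0 i < p 0 i < b 0 i].

Definition boundary A : set 'rV[R]_2 := closure A `\` interior A.

(* Since the domain is open, taking the rectangles of the finite union open
   is no restriction; they are allowed to overlap. *)
Definition union_of_rects Omega : Prop :=
  exists s : seq ('rV[R]_2 * 'rV[R]_2),
    Omega = \bigcup_(r in [set` s]) open_rect r.1 r.2.

Definition domain Omega : Prop :=
  [/\ open Omega, bounded_set Omega, connected Omega & union_of_rects Omega].

(* The cell K is the rectangle with lower left corner [lo K] and upper right
   corner [hi K]. *)
Record cells := Cells {
  cell : finType;
  lo : cell -> 'rV[R]_2;
  hi : cell -> 'rV[R]_2 }.

Section Cells.
Variable M : cells.
Implicit Types (K L : cell M) (i : 'I_2) (s : bool) (sigma : set 'rV[R]_2).

Definition cell_set K : set 'rV[R]_2 := rect (lo K) (hi K).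

Definition cell_interior K : set 'rV[R]_2 := open_rect (lo K) (hi K).

Definition side K i : R := hi K 0 i - lo K 0 i.

Definition area K : R := \prod_i side K i.

(* The four edges of K are indexed by pairs (i, s): [edge K i s] is the edge of
   K orthogonal to e^(i), on the side of larger (s = true) or smaller
   (s = false) i-th coordinate.  An edge shared by two cells is one set. *)
Definition edge K i s : set 'rV[R]_2 :=
  [set p | cell_set K p /\ p 0 i = (if s then hi K else lo K) 0 i].

Definition edge_length K i : R := \prod_(j | j != i) side K j.

Definition normal i s : 'rV[R]_2 :=
  if s then basis_vec R i else - basis_vec R i.

Definition vertex K : set 'rV[R]_2 :=
  [set p | forall i, p 0 i = lo K 0 i \/ p 0 i = hi K 0 i].

Definition edges i : set (set 'rV[R]_2) :=
  [set sigma | exists K s, sigma = edge K i s].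

Definition separates sigma K L : Prop :=
  K != L /\ sigma = boundary (cell_set K) `&` boundary (cell_set L).

Definition internal sigma : Prop := exists K L, separates sigma K L.

Definition partition_of Omega : Prop :=
  [/\ forall K i, lo K 0 i < hi K 0 i,
      forall K L, K != L -> cell_interior K `&` cell_interior L = set0,
      forall K, cell_interior K `<=` Omega
    & closure Omega = \bigcup_K cell_set K].

Definition conforming : Prop :=
  forall K L, K != L ->
    [\/ cell_set K `&` cell_set L = set0,
        exists p, [/\ vertex K p, vertex L p
                    & cell_set K `&` cell_set L = [set p]]
      | exists i s s', edge K i s = edge L i s' /\
                       cell_set K `&` cell_set L = edge K i s].

(* Structured: the cells can be numbered by distinct pairs of integers so that
   crossing an edge in the direction e^(i) increments the i-th index.  Any part
   of a tensor product grid has this property. *)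
Definition structured : Prop :=
  exists idx : cell M -> 'rV[int]_2,
    injective idx /\
    forall K L i, edge K i true = edge L i false ->
      idx L = idx K + basis_vec int i.

Definition mesh Omega : Prop :=
  [/\ partition_of Omega, conforming & structured].

(* Only the values u i sigma with sigma in [edges i] are meaningful. *)
Definition vanishes_on_boundary (u : 'I_2 -> set 'rV[R]_2 -> R) : Prop :=
  forall i sigma, edges i sigma -> ~ internal sigma -> u i sigma = 0.

Definition outward (u : 'I_2 -> set 'rV[R]_2 -> R) K i s : R :=
  u i (edge K i s) * dot (normal i s) (basis_vec R i).

Definition neighbour K i s : option (cell M) :=
  [pick L | `[< separates (edge K i s) K L >]].

(* The upwind height on an edge of K, seen from K.  If sigma = K|L, then K and L
   can only disagree on it when the normal velocity, hence the flux, is zero.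
   The value on a boundary edge is a dummy, the velocity being zero there. *)
Definition upwind (h : cell M -> R) (u : 'I_2 -> set 'rV[R]_2 -> R) K i s : R :=
  if neighbour K i s is Some L then
    if 0 <= outward u K i s then h K else h L
  else 0.

Definition mass_balance (dt : R) (h h' : cell M -> R)
    (u : 'I_2 -> set 'rV[R]_2 -> R) : Prop :=
  forall K, dt^-1 * (h' K - h K) +
    (area K)^-1 *
      (\sum_(i : 'I_2) \sum_(s : bool)
         edge_length K i * upwind h u K i s * outward u K i s) = 0.

Definition cfl_denominator (u : 'I_2 -> set 'rV[R]_2 -> R) K : R :=
  \sum_(i : 'I_2) \sum_(s : bool) edge_length K i * `|outward u K i s|.

Definition cfl_bound (u : 'I_2 -> set 'rV[R]_2 -> R) K : \bar R :=
  if cfl_denominator u K == 0 then +oo%E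
  else (area K / cfl_denominator u K)%:E.

Definition cfl (dt : R) (u : 'I_2 -> set 'rV[R]_2 -> R) : Prop :=
  forall K, (dt%:E <= cfl_bound u K)%E.

End Cells.
End Geometry.

(* Main.v *)
(** With D the CFL denominator of K, an upwind outflow from K carries h_K and an
    inflow carries a nonnegative neighbouring height, so the net outflow is at
    most D h_K; hence the new height is at least (1 - dt D / |K|) h_K, which is
    nonnegative under the CFL condition. *)
Require Import Defs.
From mathcomp Require Import all_boot all_order all_algebra.
From mathcomp Require Import all_classical all_reals all_analysis.

Import Order.TTheory GRing.Theory Num.Theory.

Local Open Scope classical_set_scope.
Local Open Scope ring_scope.

Lemma area_gt0 (R : realType) (Omega : set 'rV[R]_2) (M : cells R)
    (K : cell M) : partition_of M Omega -> 0 < area K.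
Proof. by case=> lo_hi _ _ _; apply: prodr_gt0 => i _; rewrite subr_gt0. Qed.

Lemma edge_length_ge0 (R : realType) (Omega : set 'rV[R]_2) (M : cells R)
    (K : cell M) (i : 'I_2) : partition_of M Omega -> 0 <= edge_length K i.
Proof.
by case=> lo_hi _ _ _; apply: prodr_ge0 => j _; rewrite subr_ge0 ltW.
Qed.

(** For an outflow this is an equality, the upwind height being [h K]. For an inflow the left side
    is a nonnegative height times a negative velocity, and without a neighbour the dummy height
    makes it 0. *)
Lemma upwind_flux_le (R : realType) (M : cells R) (h : cell M -> R)
    (u : 'I_2 -> set 'rV[R]_2 -> R) (K : cell M) (i : 'I_2) (s : bool) :
  (forall L, 0 <= h L) ->
  upwind h u K i s * outward u K i s <= h K * `|outward u K i s|.
Proof.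
move=> h_ge0; rewrite /upwind; case: neighbour => [L|]; last first.
  by rewrite mul0r mulr_ge0.
case: ifPn => [out_ge0|]; first by rewrite ger0_norm.
rewrite -ltNge => out_lt0.
apply: (@le_trans _ _ 0); last by rewrite mulr_ge0.
by rewrite mulr_ge0_le0 // ltW.
Qed.

Lemma outflow_le (R : realType) (Omega : set 'rV[R]_2) (M : cells R)
    (h : cell M -> R) (u : 'I_2 -> set 'rV[R]_2 -> R) (K : cell M) :
  partition_of M Omega -> (forall L, 0 <= h L) ->
  \sum_(i : 'I_2) \sum_(s : bool)
    edge_length K i * upwind h u K i s * outward u K i s
  <= h K * cfl_denominator u K.
Proof.
move=> part h_ge0; rewrite mulr_sumr; apply: ler_sum => i _.
rewrite mulr_sumr; apply: ler_sum => s _.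
rewrite -mulrA (mulrCA (h K)).
by apply: ler_wpM2l; [exact: edge_length_ge0 part | exact: upwind_flux_le].
Qed.

Lemma cfl_denominator_ge0 (R : realType) (Omega : set 'rV[R]_2) (M : cells R)
    (u : 'I_2 -> set 'rV[R]_2 -> R) (K : cell M) :
  partition_of M Omega -> 0 <= cfl_denominator u K.
Proof.
move=> part; apply: sumr_ge0 => i _; apply: sumr_ge0 => s _.
by rewrite mulr_ge0 // (edge_length_ge0 _ _ _ _ _ part).
Qed.

(** Clearing the denominator unifies the two cases of [cfl_bound]: where the bound is [+oo], the
    inequality reduces to [0 <= area K]. *)
Lemma cfl_le_area (R : realType) (Omega : set 'rV[R]_2) (M : cells R)
    (dt : R) (u : 'I_2 -> set 'rV[R]_2 -> R) (K : cell M) :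
  partition_of M Omega -> cfl M dt u -> dt * cfl_denominator u K <= area K.
Proof.
move=> part /(_ K); rewrite /cfl_bound; case: eqP => [-> _|/eqP D_neq0].
  by rewrite mulr0 ltW // (area_gt0 _ _ _ _ part).
by rewrite lee_fin ler_pdivlMr // lt0r D_neq0 (cfl_denominator_ge0 _ _ _ _ _ part).
Qed.

Theorem lemma1 (R : realType) (Omega : set 'rV[R]_2) (M : cells R)
    (T : R) (N n : nat)
    (h : nat -> cell M -> R) (u : nat -> 'I_2 -> set 'rV[R]_2 -> R)
    (Omega_domain : domain Omega) (M_mesh : mesh M Omega)
    (T_gt0 : 0 < T) (N_ge1 : (1 <= N)%N) (n_le : (n <= N - 1)%N)
    (u_boundary : vanishes_on_boundary M (u n))
    (h_ge0 : forall K, 0 <= h n K)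
    (balance : mass_balance (T / N%:R) (h n) (h n.+1) (u n))
    (CFL : cfl M (T / N%:R) (u n)) :
  forall K, 0 <= h n.+1 K.
Proof.
move=> K; have [part _ _] := M_mesh.
have dt_gt0 : 0 < T / N%:R by rewrite divr_gt0 // ltr0n.
move: (balance K) (cfl_le_area _ _ _ _ _ K part CFL).
move: (outflow_le _ _ _ _ (u n) K part h_ge0) (area_gt0 _ _ _ K part).
move: dt_gt0; set dt := T / N%:R; set F := \sum_(i < 2) _.
move=> dt_gt0 F_le A_gt0 /eqP bal dtD_le.
have {bal} -> : h n.+1 K = h n K - dt * F / area K.
  move: bal; rewrite addr_eq0 => /eqP bal.
  (* The increment of the height is written as [dt * (dt^-1 * _)], so that the balance can replace
     the inner product. *)
  rewrite -[LHS](subrK (h n K)) addrC -(mulVKf (lt0r_neq0 dt_gt0) (_ - h n K)).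
  by rewrite bal mulrN mulrA mulrAC.
rewrite subr_ge0 ler_pdivrMr //.
(* The intermediate term bounds the net outflow by [outflow_le]; factoring out [h n K >= 0] then
   leaves exactly the CFL inequality [dtD_le]. *)
apply: (@le_trans _ _ (dt * (h n K * cfl_denominator (u n) K))).
  by rewrite ler_pM2l.
by rewrite mulrCA ler_wpM2l.
Qed.
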